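(* Let $A$ be a nonzero matrix that is either an SPC matrix in $M_k\otimes M_k$ or a PPT matrix in $M_k\otimes M_m$. Let $A=\sum_{i=1}^n\lambda_i\gamma_i\otimes\delta_i$ be a Hermitian Schmidt decomposition with $\lambda_1\geq\dots\geq\lambda_n>0$ (with $\delta_i=\gamma_i$ for all $i$ in the SPC case). Then $A$ is weak irreducible if and only if the following three conditions hold: 1. $\lambda_1>\lambda_2\geq\dots\geq\lambda_n>0$; 2. $\Im(\gamma_i)\subset\Im(\gamma_1)$ for $1\leq i\leq n$; 3. $\Im(\delta_i)\subset\Im(\delta_1)$ for $1\leq i\leq n$.
   Context: $M_k$ denotes the complex $k\times k$ matrices, and $M_k\otimes M_m$ is identified with $M_{km}$ via the Kronecker product. $M_k$ carries the inner product $\langle C,D\rangle=\mathrm{tr}(CD^* )$. $\Im(X)$ denotes the image (column space) of a matrix $X$. A Hermitian projection is an orthogonal projection matrix. A Hermitian Schmidt decomposition of a Hermitian $A\in M_k\otimes M_m$ is an expression $A=\sum_{i=1}^n\lambda_i\gamma_i\otimes\delta_i$ with real $\lambda_i>0$, where $\{\gamma_1,\dots,\gamma_n\}\subset M_k$ and $\{\delta_1,\dots,\delta_n\}\subset M_m$ are orthonormal sets of Hermitian matrices. A positive semidefinite Hermitian matrix $A\in M_k\otimes M_k$ is SPC (symmetric with positive coefficients) if it has a Hermitian Schmidt decomposition of the form $A=\sum_{i=1}^n\lambda_i\gamma_i\otimes\gamma_i$ with all $\lambda_i>0$. A positive semidefinite Hermitian matrix $A=\sum_i A_i\otimes B_i\in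 M_k\otimes M_m$ is PPT (positive under partial transposition) if $A^{t_1}=\sum_i A_i^t\otimes B_i$ is also positive semidefinite Hermitian. A positive semidefinite Hermitian matrix $A\in M_k\otimes M_m$ is weak irreducible if, for all Hermitian projections $V_1,V_2\in M_k$ and $W_1,W_2\in M_m$ with $V_1V_2=0$, $W_1W_2=0$, $V_1+V_2=Id\in M_k$ and $W_1+W_2=Id\in M_m$, the equality $A=\sum_{i=1}^2(V_i\otimes W_i)A(V_i\otimes W_i)$ implies that $(V_1\otimes W_1)A(V_1\otimes W_1)=0$ or $(V_2\otimes W_2)A(V_2\otimes W_2)=0$. *)

(* Defs.v *)
From mathcomp Require Import all_boot all_order all_algebra.
From mathcomp Require Import reals.
From mathcomp Require Import complex mxtens.

Set Implicit Arguments.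
Unset Strict Implicit.
Unset Printing Implicit Defensive.

Import Order.TTheory GRing.Theory Num.Theory.
Local Open Scope ring_scope.
Local Open Scope complex_scope.

Section Matrices.
Variable C : numClosedFieldType.

Definition adjmx k l (X : 'M[C]_(k, l)) : 'M[C]_(l, k) := map_mx Num.conj X^T.

Definition trdot k (X Y : 'M[C]_k) : C := \tr (X *m adjmx Y).

(* In the order of a numClosedFieldType, 0 <= z forces z to be real. *)
Definition psd k (A : 'M[C]_k) : Prop :=
  A \is hermsymmx /\ forall v : 'cV[C]_k, 0 <= (adjmx v *m A *m v) 0 0.

Definition herm_projection k (V : 'M[C]_k) : Prop :=
  V \is hermsymmx /\ V *m V = V.

(* mxalgebra compares row spaces, hence the transposes. *)
Definition im_sub k l p (X : 'M[C]_(k, l)) (Y : 'M[C]_(k, p)) : bool :=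
  (X^T <= Y^T)%MS.

Lemma im_subP k l p (X : 'M[C]_(k, l)) (Y : 'M[C]_(k, p)) :
  im_sub X Y <->
  (forall v : 'cV[C]_k, (exists w, v = X *m w) -> (exists w, v = Y *m w)).
Proof.
split.
  move=> /submxP[D XD] v [w ->]; exists (D^T *m w).
  by rewrite mulmxA -[Y]trmxK -trmx_mul -XD trmxK.
move=> h; apply/row_subP => i; rewrite -tr_col.
have [w e] := h (col i X) (ex_intro _ _ (colE i X)).
by rewrite e trmx_mul submxMl.
Qed.

(* The map X (x) Y |-> X^T (x) Y, extended linearly: it exchanges the first
   components of the row and column indices (see ptrans1_tens). *)
Definition ptrans1 k m (A : 'M[C]_(k * m)) : 'M[C]_(k * m) :=
  \matrix_(a, b)
     A (mxtens_index ((mxtens_unindex b).1, (mxtens_unindex a).2))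
       (mxtens_index ((mxtens_unindex a).1, (mxtens_unindex b).2)).

Lemma ptrans1_tens k m n (X : 'I_n -> 'M[C]_k) (Y : 'I_n -> 'M[C]_m) :
  ptrans1 (\sum_i X i *t Y i) = \sum_i (X i)^T *t Y i.
Proof.
apply/matrixP => a b; rewrite mxE !summxE; apply: eq_bigr => i _.
by rewrite tensmxE !mxE.
Qed.

Definition PPT k m (A : 'M[C]_(k * m)) : Prop := psd A /\ psd (ptrans1 A).

Definition weak_irreducible k m (A : 'M[C]_(k * m)) : Prop :=
  psd A /\
  forall (V1 V2 : 'M[C]_k) (W1 W2 : 'M[C]_m),
    herm_projection V1 -> herm_projection V2 ->
    herm_projection W1 -> herm_projection W2 ->
    V1 *m V2 = 0 -> W1 *m W2 = 0 ->
    V1 + V2 = 1%:M -> W1 + W2 = 1%:M ->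
    A = (V1 *t W1) *m A *m (V1 *t W1) + (V2 *t W2) *m A *m (V2 *t W2) ->
    (V1 *t W1) *m A *m (V1 *t W1) = 0 \/ (V2 *t W2) *m A *m (V2 *t W2) = 0.

Definition orthonormal_herm k n (g : 'I_n -> 'M[C]_k) : Prop :=
  (forall i, g i \is hermsymmx) /\
  (forall i j, trdot (g i) (g j) = (i == j)%:R).

End Matrices.

Definition herm_schmidt (R : realType) k m n (lam : 'I_n -> R)
    (g : 'I_n -> 'M[R[i]]_k) (d : 'I_n -> 'M[R[i]]_m)
    (A : 'M[R[i]]_(k * m)) : Prop :=
  [/\ forall i, 0 < lam i, orthonormal_herm g, orthonormal_herm d &
      A = \sum_i (lam i)%:C *: (g i *t d i)].

Definition SPC (R : realType) k (A : 'M[R[i]]_(k * k)) : Prop :=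
  psd A /\
  exists n (lam : 'I_n -> R) (g : 'I_n -> 'M[R[i]]_k), herm_schmidt lam g g A.

(* Indices are shifted by one: lambda_1 is lam ord0 and lambda_2, when it
   exists, is lam at the index of value 1. *)
Definition schmidt_conditions (R : realType) k m n (lam : 'I_n.+1 -> R)
    (g : 'I_n.+1 -> 'M[R[i]]_k) (d : 'I_n.+1 -> 'M[R[i]]_m) : Prop :=
  [/\ [/\ forall i : 'I_n.+1, i = 1%N :> nat -> lam i < lam ord0,
          forall i j : 'I_n.+1, (0 < i)%N -> (i <= j)%N -> lam j <= lam i &
          forall i, 0 < lam i],
      forall i, im_sub (g i) (g ord0) &
      forall i, im_sub (d i) (d ord0)].

(* Main.v *)
(* A defines the map G(X) = \sum_i l_i tr(g_i X) d_i, positive because A is,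
   and g_1, d_1 are top singular vectors of G. Positivity of A gives tr(A (X
   (x) Y)) <= tr(A (|X| (x) |Y|)), so by the equality case of Cauchy-Schwarz
   the top singular pairs (X, Y) are stable under passing to positive and
   negative parts. If X and Y are in addition positive semidefinite, with range
   projections V and W, then A annihilates V (x) (1 - W) and (1 - V) (x) W, and
   under PPT or SPC the remaining off-diagonal blocks vanish too, so A = (V (x)
   W) A (V (x) W) + (V' (x) W') A (V' (x) W') with V' = 1 - V and W' = 1 - W,
   and weak irreducibility forces the second block to be 0. Hence every g_i
   lives on V and every d_i on W. Taking X = |g_1| gives the inclusions of
   images; if the top singular value were not simple, a traceless X would give
   two such pairs with orthogonal ranges. Conversely, a block decomposition of
   A makes V_1 commute with the singular structure, so that g_1, being simple,
   lies in one of the blocks, and with it all the g_i. *)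
Require Import Defs.
From mathcomp Require Import all_boot all_order all_algebra.
From mathcomp Require Import reals complex mxtens ring.
Import Order.TTheory GRing.Theory Num.Theory.
Local Open Scope ring_scope.

Set Implicit Arguments.
Unset Strict Implicit.
Unset Printing Implicit Defensive.

(** * Adjoints, traces and the Frobenius norm *)

Section Adjoint.
Variable C : numClosedFieldType.
Implicit Types k l p : nat.

Lemma adjmxK k l (X : 'M[C]_(k, l)) : adjmx (adjmx X) = X.
Proof. by apply/matrixP => i j; rewrite !mxE conjCK. Qed.

Lemma adjmxM k l p (X : 'M[C]_(k, l)) (Y : 'M[C]_(l, p)) :
  adjmx (X *m Y) = adjmx Y *m adjmx X.
Proof. by rewrite /adjmx trmx_mul map_mxM. Qed.

Lemma adjmxD k l (X Y : 'M[C]_(k, l)) : adjmx (X + Y) = adjmx X + adjmx Y.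
Proof. by apply/matrixP => i j; rewrite !mxE rmorphD. Qed.

Lemma adjmxB k l (X Y : 'M[C]_(k, l)) : adjmx (X - Y) = adjmx X - adjmx Y.
Proof. by apply/matrixP => i j; rewrite !mxE rmorphB. Qed.

Lemma adjmxZ k l a (X : 'M[C]_(k, l)) : adjmx (a *: X) = a^* *: adjmx X.
Proof. by apply/matrixP => i j; rewrite !mxE rmorphM. Qed.

Lemma adjmx0 k l : adjmx (0 : 'M[C]_(k, l)) = 0.
Proof. by apply/matrixP => i j; rewrite !mxE rmorph0. Qed.

Lemma adjmx1 k : adjmx (1%:M : 'M[C]_k) = 1%:M.
Proof. by apply/matrixP => i j; rewrite !mxE eq_sym conjC_nat. Qed.

Lemma adjmx_tens k l p q (X : 'M[C]_(k, l)) (Y : 'M[C]_(p, q)) :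
  adjmx (X *t Y) = adjmx X *t adjmx Y.
Proof. by rewrite /adjmx trmx_tens map_mxT. Qed.

Lemma adjmx_diag k (v : 'rV[C]_k) :
  adjmx (diag_mx v) = diag_mx (map_mx Num.conj v).
Proof. by rewrite /adjmx tr_diag_mx map_diag_mx. Qed.

Lemma tr_adjmx k (X : 'M[C]_k) : \tr (adjmx X) = (\tr X)^*.
Proof. by rewrite /adjmx trace_map_mx mxtrace_tr. Qed.

Lemma hermP k (X : 'M[C]_k) : reflect (adjmx X = X) (X \is hermsymmx).
Proof.
have -> : (X \is hermsymmx) = (X == adjmx X).
  by rewrite is_hermitianmxE expr0 scale1r /adjmx.
by rewrite eq_sym; apply: eqP.
Qed.

Lemma tr_gram k l (X : 'M[C]_(k, l)) :
  \tr (X *m adjmx X) = \sum_i \sum_j `|X i j| ^+ 2.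
Proof.
rewrite /mxtrace; apply: eq_bigr => i _; rewrite mxE; apply: eq_bigr => j _.
by rewrite !mxE normCK.
Qed.

Lemma tr_gram_ge0 k l (X : 'M[C]_(k, l)) : 0 <= \tr (X *m adjmx X).
Proof.
by rewrite tr_gram; do 2!apply: sumr_ge0 => ? _; rewrite exprn_ge0.
Qed.

Lemma tr_gram_eq0 k l (X : 'M[C]_(k, l)) : \tr (X *m adjmx X) = 0 -> X = 0.
Proof.
rewrite tr_gram => /eqP.
rewrite psumr_eq0 => [|i _]; last by apply: sumr_ge0 => j _; rewrite exprn_ge0.
move=> /allP X0; apply/matrixP => i j; rewrite mxE.
have /= := X0 i (mem_index_enum i).
rewrite psumr_eq0 => [/allP /(_ j (mem_index_enum j))|? _];
  last by rewrite exprn_ge0.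
by rewrite /= expf_eq0 /= normr_eq0 => /eqP.
Qed.

Lemma mxtrace_tens k m (X : 'M[C]_k) (Y : 'M[C]_m) :
  \tr (X *t Y) = \tr X * \tr Y.
Proof.
rewrite /mxtrace mulr_sum; apply: eq_bigr => i _.
by case: (mxtens_indexP i) => a b; rewrite tensmxE mxtens_indexK.
Qed.

Lemma tr_herm_real k (X Y : 'M[C]_k) :
  X \is hermsymmx -> Y \is hermsymmx -> \tr (X *m Y) \is Num.real.
Proof.
move=> /hermP hX /hermP hY; apply/CrealP.
by rewrite -tr_adjmx adjmxM hX hY mxtrace_mulC.
Qed.

End Adjoint.

(** * Functional calculus of Hermitian matrices *)

Section FunctionalCalculus.
Variable C : numClosedFieldType.
Variable k : nat.
Implicit Types (X : 'M[C]_k) (f h : C -> C).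

(** [spectralmx X] is unitary for every [X], so the algebraic laws hold without a hypothesis;
    hermiticity enters through [fcalc_id] and through the reality of the eigenvalues. *)
Definition fcalc f X : 'M[C]_k :=
  adjmx (spectralmx X) *m diag_mx (map_mx f (spectral_diag X))
    *m spectralmx X.

Lemma spectralmxK X : spectralmx X *m adjmx (spectralmx X) = 1%:M.
Proof. exact/unitarymxP/spectral_unitarymx. Qed.

Lemma fcalc_id X : X \is hermsymmx -> fcalc id X = X.
Proof.
move=> /hermitian_normalmx /orthomx_spectralP hX.
by rewrite [RHS]hX /fcalc map_mx_id // invmx_unitary // spectral_unitarymx.
Qed.

Lemma fcalcM f h X : fcalc f X *m fcalc h X = fcalc (fun x => f x * h x) X.
Proof.
rewrite /fcalc !mulmxA -[_ *m spectralmx X *m adjmx _]mulmxA spectralmxK mulmx1.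
rewrite -[_ *m diag_mx _ *m diag_mx _]mulmxA mulmx_diag.
by congr (_ *m diag_mx _ *m _); apply/rowP => i; rewrite !mxE.
Qed.

Lemma fcalcD f h X : fcalc f X + fcalc h X = fcalc (fun x => f x + h x) X.
Proof.
rewrite /fcalc -mulmxDl -mulmxDr -raddfD /=; congr (_ *m diag_mx _ *m _).
by apply/rowP => i; rewrite !mxE.
Qed.

Lemma fcalcN f X : - fcalc f X = fcalc (fun x => - f x) X.
Proof.
rewrite /fcalc -mulNmx -mulmxN -raddfN /=; congr (_ *m diag_mx _ *m _).
by apply/rowP => i; rewrite !mxE.
Qed.

Lemma eq_fcalc f h X : X \is hermsymmx ->
  {in Num.real, f =1 h} -> fcalc f X = fcalc h X.
Proof.
move=> /hermitian_spectral_diag_real /mxOverP hX fh.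
rewrite /fcalc; congr (_ *m diag_mx _ *m _).
by apply/rowP => i; rewrite !mxE fh.
Qed.

Lemma adj_fcalc f X : adjmx (fcalc f X) = fcalc (fun x => (f x)^*) X.
Proof.
rewrite /fcalc !adjmxM adjmxK adjmx_diag !mulmxA.
by congr (_ *m diag_mx _ *m _); apply/rowP => i; rewrite !mxE.
Qed.

Lemma fcalc0 X : fcalc (fun=> 0) X = 0.
Proof.
rewrite /fcalc [map_mx _ _](_ : _ = 0) ?raddf0 ?mulmx0 ?mul0mx //.
by apply/rowP => i; rewrite !mxE.
Qed.

Lemma psd_gram l (S : 'M[C]_(k, l)) : psd (S *m adjmx S).
Proof.
split=> [|v]; first by apply/hermP; rewrite adjmxM adjmxK.
have -> : (adjmx v *m (S *m adjmx S) *m v) 0 0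
        = \tr (adjmx v *m S *m adjmx (adjmx v *m S)).
  by rewrite /mxtrace big_ord1 adjmxM adjmxK !mulmxA.
exact: tr_gram_ge0.
Qed.

Lemma psd_fcalc f X : X \is hermsymmx ->
  {in Num.real, forall x, 0 <= f x} -> psd (fcalc f X).
Proof.
move=> hX f0.
suff -> : fcalc f X = fcalc (fun x => sqrtC (f x)) X
                        *m adjmx (fcalc (fun x => sqrtC (f x)) X).
  exact: psd_gram.
rewrite adj_fcalc fcalcM; apply: eq_fcalc => // x xR.
rewrite (CrealP _) -?expr2 ?sqrtCK //.
by rewrite ger0_real // sqrtC_ge0 f0.
Qed.

Lemma psd_sqrt X : psd X -> exists S : 'M[C]_k, X = S *m adjmx S.
Proof.
move=> [hX pX]; exists (fcalc sqrtC X).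
rewrite adj_fcalc fcalcM -{1}[X]fcalc_id // /fcalc.
congr (_ *m diag_mx _ *m _); apply/rowP => i; rewrite !mxE.
(* Positivity tested on the [i]-th eigenvector shows that the [i]-th eigenvalue is nonnegative. *)
have := pX (adjmx (spectralmx X) *m delta_mx i 0).
rewrite adjmxM adjmxK -{2}[X]fcalc_id // /fcalc map_mx_id // !mulmxA.
rewrite -[_ *m spectralmx X *m adjmx (spectralmx X)]mulmxA spectralmxK mulmx1.
rewrite -[_ *m spectralmx X *m adjmx (spectralmx X)]mulmxA spectralmxK mulmx1.
rewrite -mulmxA -colE mxE (bigD1 i) //= !mxE !eqxx /= conjC1 mul1r mulr1n.
rewrite big1 ?addr0 => [xi0|j /negPf ji]; last by rewrite !mxE ji rmorph0 mul0r.
by rewrite [(sqrtC _)^*](CrealP _) -?expr2 ?sqrtCK // ger0_real // sqrtC_ge0.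
Qed.

End FunctionalCalculus.

(** * Positive part, negative part and range projection *)

Section SpectralParts.
Variable C : numClosedFieldType.
Variable k : nat.
Implicit Types X : 'M[C]_k.

Definition pospart X := fcalc (fun x => if 0 <= x then x else 0) X.
Definition negpart X := fcalc (fun x => if 0 <= x then 0 else - x) X.
Definition range_proj X := fcalc (fun x => (x != 0)%:R) X.

Variable X : 'M[C]_k.
Hypothesis hX : X \is hermsymmx.

Lemma mul_fcalc f : X *m fcalc f X = fcalc (fun x => x * f x) X.
Proof. by rewrite -{1}(fcalc_id hX) fcalcM. Qed.

Lemma psd_pospart : psd (pospart X).
Proof. by apply: psd_fcalc => // x _; case: ifP. Qed.

Lemma psd_negpart : psd (negpart X).
Proof.
apply: psd_fcalc => // x xR; case: (real_ge0P xR) => // x0.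
by rewrite oppr_ge0 ltW.
Qed.

Lemma pospartB : pospart X - negpart X = X.
Proof.
rewrite /pospart /negpart fcalcN fcalcD -[RHS]fcalc_id //.
by apply: eq_fcalc => // x _ /=; case: ifP; rewrite ?subr0 // sub0r opprK.
Qed.

Lemma pos_neg_mul0 : pospart X *m negpart X = 0.
Proof.
rewrite fcalcM -(fcalc0 X); apply: eq_fcalc => // x _.
by case: ifP; rewrite ?mulr0 ?mul0r.
Qed.

(** The sum of the two parts is |X|. Its square and that of [X] differ only in the cross terms,
    whose traces vanish because the parts have product 0. *)
Lemma tr_sqr_abs :
  \tr ((pospart X + negpart X) *m (pospart X + negpart X)) = \tr (X *m X).
Proof.
have PN := pos_neg_mul0.
have NP : \tr (negpart X *m pospart X) = 0 by rewrite mxtrace_mulC PN mxtrace0.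
move: (pospart X) (negpart X) PN NP pospartB => P N PN NP <-.
rewrite !(mulmxDl, mulmxDr, mulmxN, mulNmx) !PN.
by rewrite oppr0 !addr0 opprK !mxtraceD raddfN /= NP oppr0.
Qed.

Lemma pospartD_image : exists S : 'M[C]_k, pospart X + negpart X = X *m S.
Proof.
(* The witness is the sign of [X], as |x| = x sgn(x) for real x. *)
exists (fcalc (fun x => if 0 <= x then 1 else -1) X).
rewrite mul_fcalc fcalcD.
apply: eq_fcalc => // x _.
by case: ifP; rewrite ?mulr1 ?addr0 // mulrN1 add0r.
Qed.

Lemma herm_projection_range_proj : herm_projection (range_proj X).
Proof.
split.
  apply/hermP; rewrite adj_fcalc; apply: eq_fcalc => // x _.
  exact: conjC_nat.
rewrite fcalcM; apply: eq_fcalc => // x _.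
by case: (x != 0); rewrite ?mulr1 ?mulr0.
Qed.

Lemma range_proj_mul : range_proj X *m X = X.
Proof.
transitivity (fcalc (fun x => (x != 0)%:R * x) X).
  by rewrite -fcalcM (fcalc_id hX).
rewrite -[RHS]fcalc_id //; apply: eq_fcalc => // x _.
by case: eqP => [->|_]; rewrite ?mul0r ?mul1r.
Qed.

Lemma range_proj_image : exists Z : 'M[C]_k, range_proj X = X *m Z.
Proof.
(* With the convention 0^-1 = 0 this is the pseudo-inverse of [X]. *)
exists (fcalc (fun x => x^-1) X).
rewrite mul_fcalc.
apply: eq_fcalc => // x _.
by have [->|x0] := eqVneq x 0; rewrite ?mul0r ?mulfV.
Qed.

End SpectralParts.

(** * Positive semidefinite matrices and projections *)

Section Psd.
Variable C : numClosedFieldType.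

Lemma psd_herm k (X : 'M[C]_k) : psd X -> X \is hermsymmx.
Proof. by case. Qed.

Lemma psd_tens k m (X : 'M[C]_k) (Y : 'M[C]_m) :
  psd X -> psd Y -> psd (X *t Y).
Proof.
move=> /psd_sqrt [S ->] /psd_sqrt [T ->].
by rewrite -tensmx_mul -adjmx_tens; apply: psd_gram.
Qed.

Lemma herm_projection_psd k (V : 'M[C]_k) : herm_projection V -> psd V.
Proof. by move=> [/hermP hV <-]; rewrite -{2}hV; apply: psd_gram. Qed.

Lemma herm_projection_compl k (V : 'M[C]_k) :
  herm_projection V -> herm_projection (1%:M - V).
Proof.
move=> [/hermP hV VV]; split; first by apply/hermP; rewrite adjmxB adjmx1 hV.
by rewrite mulmxBl mul1mx mulmxBr mulmx1 VV subrr subr0.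
Qed.

(** By cyclicity the trace is the squared Frobenius norm of S^* T. It is thus nonnegative, and when
    it is 0 the factor S^* T inside [X *m Y] vanishes. *)
Lemma tr_psd_mulE k (X Y : 'M[C]_k) (S T : 'M[C]_k) :
  X = S *m adjmx S -> Y = T *m adjmx T ->
  \tr (X *m Y) = \tr ((adjmx S *m T) *m adjmx (adjmx S *m T)).
Proof.
move=> -> ->; rewrite adjmxM adjmxK -!mulmxA mxtrace_mulC.
by rewrite -!mulmxA.
Qed.

Lemma tr_psd_mul_ge0 k (X Y : 'M[C]_k) : psd X -> psd Y -> 0 <= \tr (X *m Y).
Proof.
move=> /psd_sqrt [S eX] /psd_sqrt [T eY].
by rewrite (tr_psd_mulE eX eY); apply: tr_gram_ge0.
Qed.

Lemma tr_psd_mul_eq0 k (X Y : 'M[C]_k) :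
  psd X -> psd Y -> \tr (X *m Y) = 0 -> X *m Y = 0.
Proof.
move=> /psd_sqrt [S eX] /psd_sqrt [T eY]; rewrite (tr_psd_mulE eX eY).
move=> /tr_gram_eq0 ST0.
by rewrite eX eY mulmxA -[S *m _ *m T]mulmxA ST0 mulmx0 mul0mx.
Qed.

Lemma psd_tr_eq0 k (X : 'M[C]_k) : psd X -> \tr X = 0 -> X = 0.
Proof. by move=> /psd_sqrt [S ->] /tr_gram_eq0 ->; rewrite mul0mx. Qed.

Lemma herm_sqr_eq0 k (X : 'M[C]_k) : X \is hermsymmx -> X *m X = 0 -> X = 0.
Proof.
move=> /hermP hX XX; apply: tr_gram_eq0.
by rewrite hX XX mxtrace0.
Qed.

End Psd.

(** * Linear maps on sums of elementary tensors *)

Section TensorSums.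
Variable C : numClosedFieldType.
Variables k m p q n : nat.

(** The product X Z Y is bilinear in X and Y, so it factors through the tensor product; in entries
    it is a combination of the entries of the tensor sum. *)
Lemma tens_sum_contract (X : 'I_n -> 'M[C]_(k, m)) (Y : 'I_n -> 'M[C]_(p, q))
    (Z : 'M[C]_(m, p)) :
  \sum_i X i *t Y i = 0 -> \sum_i X i *m Z *m Y i = 0.
Proof.
move=> XY0; apply/matrixP => a b; rewrite summxE mxE.
transitivity (\sum_r \sum_s Z s r * \sum_i X i a s * Y i r b).
  under eq_bigr => i _.
    rewrite mxE; under eq_bigr => r _.
      rewrite mxE big_distrl /=; under eq_bigr => s _.
        rewrite mulrAC mulrC; over.
      over.
    over.
  rewrite exchange_big /=; apply: eq_bigr => r _.
  rewrite exchange_big /=; apply: eq_bigr => s _.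
  by rewrite big_distrr.
apply: big1 => r _; apply: big1 => s _.
move/matrixP: XY0 => /(_ (mxtens_index (a, r)) (mxtens_index (s, b))).
rewrite summxE mxE; under eq_bigr do rewrite tensmxE.
by move=> ->; rewrite mulr0.
Qed.

(** The slice map id (x) tr(. Z), given by entries so that it is defined on all matrices and not
    only on elementary tensors. *)
Definition partial_trace (Z : 'M[C]_(q, p)) (T : 'M[C]_(k * p, m * q)) :
    'M[C]_(k, m) :=
  \matrix_(a, b) \sum_r \sum_s
     Z s r * T (mxtens_index (a, r)) (mxtens_index (b, s)).

Lemma partial_trace_sum (X : 'I_n -> 'M[C]_(k, m)) (Y : 'I_n -> 'M[C]_(p, q))
    (Z : 'M[C]_(q, p)) :
  partial_trace Z (\sum_i X i *t Y i) = \sum_i \tr (Y i *m Z) *: X i.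
Proof.
apply/matrixP => a b; rewrite summxE mxE.
under [RHS]eq_bigr => i _.
  rewrite mxE /mxtrace big_distrl /=; under eq_bigr => r _.
    rewrite mxE big_distrl /=; under eq_bigr => s _.
      rewrite mulrC [Y _ _ _ * _]mulrC mulrCA; over.
    over.
  over.
rewrite [RHS]exchange_big /=; apply: eq_bigr => r _.
rewrite [RHS]exchange_big /=; apply: eq_bigr => s _.
by rewrite summxE big_distrr /=; apply: eq_bigr => i _; rewrite tensmxE.
Qed.

Lemma partial_trace0 (Z : 'M[C]_(q, p)) :
  partial_trace Z (0 : 'M[C]_(k * p, m * q)) = 0.
Proof.
apply/matrixP => a b; rewrite !mxE big1 // => r _; rewrite big1 // => s _.
by rewrite mxE mulr0.
Qed.

End TensorSums.

(** * Tensor identities and block decompositions *)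

Section TensorAlgebra.
Variable C : numClosedFieldType.

Lemma tens_sum_swap k m p q n (X : 'I_n -> 'M[C]_(k, m))
    (Y : 'I_n -> 'M[C]_(p, q)) :
  \sum_i X i *t Y i = 0 -> \sum_i Y i *t X i = 0.
Proof.
move=> XY0; apply/matrixP => a b.
case: (mxtens_indexP a) => a1 a2; case: (mxtens_indexP b) => b1 b2.
move/matrixP: XY0 => /(_ (mxtens_index (a2, a1)) (mxtens_index (b2, b1))).
rewrite !summxE !mxE => XY0; rewrite -[RHS]XY0; apply: eq_bigr => i _.
by rewrite !tensmxE mulrC.
Qed.

Lemma tensZl k m p q c (X : 'M[C]_(k, m)) (Y : 'M[C]_(p, q)) :
  c *: (X *t Y) = (c *: X) *t Y.
Proof. by apply/matrixP => a b; rewrite !mxE mulrA. Qed.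

Lemma tensDl k m p q (X X' : 'M[C]_(k, m)) (Y : 'M[C]_(p, q)) :
  (X + X') *t Y = X *t Y + X' *t Y.
Proof. by apply/matrixP => a b; rewrite !mxE mulrDl. Qed.

Lemma tensDr k m p q (X : 'M[C]_(k, m)) (Y Y' : 'M[C]_(p, q)) :
  X *t (Y + Y') = X *t Y + X *t Y'.
Proof. by apply/matrixP => a b; rewrite !mxE mulrDr. Qed.

Lemma tensNl k m p q (X : 'M[C]_(k, m)) (Y : 'M[C]_(p, q)) :
  (- X) *t Y = - (X *t Y).
Proof. by apply/matrixP => a b; rewrite !mxE mulNr. Qed.

Lemma tensNr k m p q (X : 'M[C]_(k, m)) (Y : 'M[C]_(p, q)) :
  X *t (- Y) = - (X *t Y).
Proof. by apply/matrixP => a b; rewrite !mxE mulrN. Qed.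

Lemma tens1 k m : (1%:M : 'M[C]_k) *t (1%:M : 'M[C]_m) = 1%:M.
Proof.
apply/matrixP => a b.
case: (mxtens_indexP a) => a1 a2; case: (mxtens_indexP b) => b1 b2.
rewrite tensmxE !mxE (can_eq (@mxtens_indexK _ _)) xpair_eqE.
by case: (a1 == b1); rewrite ?mul1r ?mul0r.
Qed.

Lemma im_sub_mul q p s (X : 'M[C]_(q, p)) (Z : 'M[C]_(p, s)) :
  im_sub (X *m Z) X.
Proof. by rewrite /im_sub trmx_mul submxMl. Qed.

(** Taking adjoints gives both q A p = 0 and A = p A + q A. Substituting A = A p + A q into the
    latter leaves only the diagonal blocks. *)
Lemma block_split N (A p q : 'M[C]_N) :
    A \is hermsymmx -> p \is hermsymmx -> q \is hermsymmx ->
    A = A *m p + A *m q -> p *m A *m q = 0 ->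
  A = p *m A *m p + q *m A *m q.
Proof.
move=> /hermP hA /hermP hp /hermP hq eA pAq.
have qAp : q *m A *m p = 0 by rewrite -hp -hA -hq -!adjmxM mulmxA pAq adjmx0.
have eA' : A = p *m A + q *m A.
  by rewrite -{1}hA {1}eA adjmxD !adjmxM hA hp hq.
rewrite {1}eA' {1 2}eA !mulmxDr !mulmxA pAq qAp.
by rewrite addr0 add0r.
Qed.

End TensorAlgebra.

(** * Coordinates in an orthonormal family *)

Section Orthonormal.
Variable C : numClosedFieldType.
Variables k n : nat.
Variable g : 'I_n -> 'M[C]_k.
Hypothesis hg : orthonormal_herm g.

Lemma tr_orthonormal i j : \tr (g i *m g j) = (i == j)%:R.
Proof. by have [/(_ j)/hermP gj <-] := hg; rewrite /trdot gj. Qed.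

Lemma orthonormal_neq0 i : g i != 0.
Proof.
apply/eqP => gi0; have := tr_orthonormal i i.
by rewrite gi0 mulmx0 mxtrace0 eqxx => /eqP; rewrite eq_sym oner_eq0.
Qed.

Lemma herm_combination a : (forall i, a i \is Num.real) ->
  \sum_i a i *: g i \is hermsymmx.
Proof.
move=> aR; apply/hermP.
rewrite (big_morph _ (@adjmxD C k k) (@adjmx0 C k k)); apply: eq_bigr => i _.
by rewrite adjmxZ (CrealP (aR i)) (hermP _ (hg.1 i)).
Qed.

Lemma tr_mul_combination (X : 'M[C]_k) (a : 'I_n -> C) :
  \tr ((\sum_i a i *: g i) *m X) = \sum_i a i * \tr (g i *m X).
Proof.
rewrite mulmx_suml raddf_sum /=; apply: eq_bigr => i _.
by rewrite -scalemxAl mxtraceZ.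
Qed.

Lemma coef_combination a j : \tr (g j *m (\sum_i a i *: g i)) = a j.
Proof.
rewrite mxtrace_mulC tr_mul_combination (bigD1 j) //= tr_orthonormal eqxx.
by rewrite mulr1 big1 ?addr0 // => i /negPf ij; rewrite tr_orthonormal ij mulr0.
Qed.

Lemma tr_sqr_combination a :
  \tr ((\sum_i a i *: g i) *m (\sum_i a i *: g i)) = \sum_i a i ^+ 2.
Proof.
by rewrite tr_mul_combination; apply: eq_bigr => i _; rewrite coef_combination.
Qed.

(** The defect in Bessel's inequality is the squared distance from [X] to the span of the family, so
    it is nonnegative and vanishes only on that span. *)
Lemma bessel_defect (X : 'M[C]_k) (a := fun i => \tr (g i *m X)) :
    X \is hermsymmx ->
  \tr (X *m X) - \sum_i a i ^+ 2
  = \tr ((X - \sum_i a i *: g i) *m adjmx (X - \sum_i a i *: g i)).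
Proof.
move=> hX.
have aR i : a i \is Num.real by apply: tr_herm_real (hg.1 i) hX.
rewrite adjmxB (hermP _ hX) (hermP _ (herm_combination aR)).
rewrite mulmxBl !mulmxBr !raddfB /= tr_sqr_combination.
rewrite [\tr (X *m \sum_i _)]mxtrace_mulC tr_mul_combination.
have -> : \sum_i a i * \tr (g i *m X) = \sum_i a i ^+ 2 by [].
by rewrite subrr addr0.
Qed.

End Orthonormal.

(** * Schmidt coefficients and partial transposition *)

Section SchmidtDecomposition.
Variable C : numClosedFieldType.
Variables k m n : nat.
Variable l : 'I_n.+1 -> C.
Variables (g : 'I_n.+1 -> 'M[C]_k) (d : 'I_n.+1 -> 'M[C]_m).
Variable A : 'M[C]_(k * m).
Hypothesis l_gt0 : forall i, 0 < l i.
Hypothesis hg : orthonormal_herm g.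
Hypothesis hd : orthonormal_herm d.
Hypothesis eA : A = \sum_i l i *: (g i *t d i).

Lemma tr_schmidt (X : 'M[C]_k) (Y : 'M[C]_m) :
  \tr (A *m (X *t Y)) = \sum_i l i * (\tr (g i *m X) * \tr (d i *m Y)).
Proof.
rewrite eA mulmx_suml raddf_sum /=; apply: eq_bigr => i _.
by rewrite -scalemxAl mxtraceZ tensmx_mul mxtrace_tens.
Qed.

Lemma mul_schmidt (P S : 'M[C]_k) (Q T : 'M[C]_m) :
  (P *t Q) *m A *m (S *t T)
  = \sum_i (l i *: (P *m g i *m S)) *t (Q *m d i *m T).
Proof.
rewrite eA mulmx_sumr mulmx_suml; apply: eq_bigr => i _.
by rewrite -scalemxAr -scalemxAl !tensmx_mul tensZl.
Qed.

(** Slicing against [d j] isolates the [j]-th term, by orthonormality. *)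
Lemma schmidt_indep_l p q (X : 'I_n.+1 -> 'M[C]_(p, q)) :
  \sum_i (l i *: X i) *t d i = 0 -> forall i, X i = 0.
Proof.
move=> X0 j; move: (congr1 (partial_trace (d j)) X0).
rewrite partial_trace_sum partial_trace0.
rewrite (bigD1 j) //= (tr_orthonormal hd) eqxx scale1r big1 ?addr0 => [/eqP|i].
  by rewrite scaler_eq0 gt_eqF //= => /eqP.
by rewrite (tr_orthonormal hd) => /negPf ->; rewrite scale0r.
Qed.

Lemma schmidt_indep_r p q (X : 'I_n.+1 -> 'M[C]_(p, q)) :
  \sum_i (l i *: g i) *t X i = 0 -> forall i, X i = 0.
Proof.
move=> X0 j; move: (congr1 (partial_trace (g j)) (tens_sum_swap X0)).
rewrite partial_trace_sum partial_trace0.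
rewrite (bigD1 j) //= -scalemxAl mxtraceZ (tr_orthonormal hg) eqxx mulr1.
rewrite big1 ?addr0 => [/eqP|i].
  by rewrite scaler_eq0 gt_eqF //= => /eqP.
move=> /negPf ij; rewrite -scalemxAl mxtraceZ (tr_orthonormal hg) ij.
by rewrite mulr0 scale0r.
Qed.

(** The difference (P (x) 1) A - A has the terms P g_i - g_i as left factors, and independence of
    the [d i] kills each of them. *)
Lemma schmidt_fix_l (P : 'M[C]_k) :
  (P *t 1%:M) *m A = A -> forall i, P *m g i = g i.
Proof.
move=> PA i; apply/eqP; rewrite -subr_eq0; apply/eqP; move: i.
apply: schmidt_indep_l.
transitivity ((P *t 1%:M) *m A *m (1%:M *t 1%:M) - A); last first.
  by rewrite tens1 mulmx1 PA subrr.
rewrite mul_schmidt [X in _ - X]eA -sumrB; apply: eq_bigr => i _.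
by rewrite mul1mx !mulmx1 tensZl scalerBr tensDl tensNl.
Qed.

Lemma schmidt_fix_r (Q : 'M[C]_m) :
  (1%:M *t Q) *m A = A -> forall i, Q *m d i = d i.
Proof.
move=> QA i; apply/eqP; rewrite -subr_eq0; apply/eqP; move: i.
apply: schmidt_indep_r.
transitivity ((1%:M *t Q) *m A *m (1%:M *t 1%:M) - A); last first.
  by rewrite tens1 mulmx1 QA subrr.
rewrite mul_schmidt [X in _ - X]eA -sumrB; apply: eq_bigr => i _.
by rewrite mul1mx !mulmx1 tensZl tensDr tensNr.
Qed.

(* The partial transpose turns the positivity of [A^{t_1}] into a statement on
   the off-diagonal blocks of [A]. *)
Lemma ppt_kernel (V : 'M[C]_k) (W : 'M[C]_m) : psd (ptrans1 A) ->
  herm_projection V -> herm_projection W ->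
  A *m (V *t W) = 0 -> (V *t 1%:M) *m A *m (1%:M *t W) = 0.
Proof.
move=> pA hV hW AVW.
have eT : ptrans1 A = \sum_i (l i *: g i)^T *t d i.
  rewrite -ptrans1_tens eA; congr ptrans1.
  by apply: eq_bigr => i _; rewrite tensZl.
have hVT : herm_projection V^T.
  case: hV => /hermP hV VV; split; last by rewrite -trmx_mul VV.
  by apply/hermP; rewrite -{2}hV /adjmx map_trmx.
have e : ptrans1 A *m (V^T *t W)
    = \sum_i (l i *: (V *m g i))^T *t (d i *m W).
  rewrite eT mulmx_suml; apply: eq_bigr => i _.
  by rewrite tensmx_mul -trmx_mul scalemxAr.
(* Transposing both left factors preserves the trace, so this trace equals tr(A (V (x) W)) = 0;
   positivity then makes the product itself vanish. *)
have /(tr_psd_mul_eq0 pA (psd_tens (herm_projection_psd hVT)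
    (herm_projection_psd hW))) : \tr (ptrans1 A *m (V^T *t W)) = 0.
  rewrite -(mxtrace0 C (k * m)) -AVW tr_schmidt e raddf_sum /=.
  apply: eq_bigr => i _; rewrite mxtrace_tens mxtrace_tr mxtraceZ.
  by rewrite mxtrace_mulC mulrA.
(* Transposing the left factors back moves [V] to the left of each g_i, while [W] stays on the right
   of d_i. *)
rewrite e => /(congr1 (@ptrans1 C k m)).
rewrite ptrans1_tens; under eq_bigr do rewrite trmxK.
rewrite [RHS](_ : _ = 0); last by apply/matrixP => a b; rewrite !mxE.
move=> <-; rewrite mul_schmidt; apply: eq_bigr => i _.
by rewrite mul1mx mulmx1.
Qed.

(** * Pairs of singular vectors for the top singular value *)

Hypothesis l_max : forall i, l i <= l ord0.

Let r := l ord0.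

(** The last equation says that [a] is supported where [l i = r]; being linear in [a], it is stable
    under combinations. Sharing [a] between [X] and [Y] makes the map attached to [A] send [X] to r
    Y. *)
Definition top_pair (X : 'M[C]_k) (Y : 'M[C]_m) := exists a : 'I_n.+1 -> C,
  [/\ forall i, a i \is Num.real, X = \sum_i a i *: g i, Y = \sum_i a i *: d i &
      forall i, l i * a i = r * a i].

Lemma top_pair_herm X Y : top_pair X Y -> X \is hermsymmx /\ Y \is hermsymmx.
Proof. by move=> [a [aR -> -> _]]; split; apply: herm_combination. Qed.

(* The equality case of [\sum_i l_i x_i y_i <= l_0 |x| |y|], where [x] and [y]
   are the coordinates of [X] and [Y]. *)
Lemma top_pair_extremal s (X : 'M[C]_k) (Y : 'M[C]_m) :
    X \is hermsymmx -> Y \is hermsymmx ->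
    \tr (X *m X) = s -> \tr (Y *m Y) = s ->
    r * s <= \tr (A *m (X *t Y)) -> top_pair X Y.
Proof.
move=> hX hY eX eY; rewrite tr_schmidt => le_s.
pose a i := \tr (g i *m X); pose b i := \tr (d i *m Y).
have aR i : a i \is Num.real by apply: tr_herm_real (hg.1 i) hX.
have bR i : b i \is Num.real by apply: tr_herm_real (hd.1 i) hY.
have sqr_ge0 (x : C) : x \is Num.real -> 0 <= x ^+ 2.
  by move=> xR; rewrite real_exprn_even_ge0.
pose f1 := s - \sum_i a i ^+ 2; pose f2 := s - \sum_i b i ^+ 2.
have := bessel_defect hg hX; have := bessel_defect hd hY.
rewrite /= eX eY -/f1 -/f2 => f2E f1E.
have f1_ge0 : 0 <= f1 by rewrite f1E tr_gram_ge0.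
have f2_ge0 : 0 <= f2 by rewrite f2E tr_gram_ge0.
pose e1 := \sum_i (r - l i) * a i ^+ 2.
pose e2 := \sum_i (r - l i) * b i ^+ 2.
pose e3 := \sum_i l i * (a i - b i) ^+ 2.
have t1 i : 0 <= (r - l i) * a i ^+ 2.
  by rewrite mulr_ge0 ?subr_ge0 ?l_max // sqr_ge0.
have t2 i : 0 <= (r - l i) * b i ^+ 2.
  by rewrite mulr_ge0 ?subr_ge0 ?l_max // sqr_ge0.
have t3 i : 0 <= l i * (a i - b i) ^+ 2.
  by rewrite mulr_ge0 ?(ltW (l_gt0 i)) // sqr_ge0 // realB.
have e1_ge0 : 0 <= e1 by apply: sumr_ge0.
have e2_ge0 : 0 <= e2 by apply: sumr_ge0.
have e3_ge0 : 0 <= e3 by apply: sumr_ge0.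
have r_gt0 : 0 < r by apply: l_gt0.
(* Twice the gap in the inequality is a sum of nonnegative terms: the Bessel defects [f1], [f2], the
   weights [e1], [e2] off the top singular value, and the mismatch [e3] of the coordinates. The gap
   is at most 0, so each term vanishes. *)
have tot : r * f1 + (r * f2 + (e1 + (e2 + e3)))
    = 2 * (r * s - \sum_i l i * (a i * b i)).
  rewrite /f1 /f2 /e1 /e2 /e3.
  have -> : \sum_i (r - l i) * a i ^+ 2 + (\sum_i (r - l i) * b i ^+ 2
      + \sum_i l i * (a i - b i) ^+ 2)
    = r * (\sum_i a i ^+ 2) + r * (\sum_i b i ^+ 2)
      - 2 * \sum_i l i * (a i * b i).
    rewrite !mulr_sumr -!big_split /= -sumrN -big_split /=.
    by apply: eq_bigr => i _; ring.
  by ring.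
have tot0 : r * f1 + (r * f2 + (e1 + (e2 + e3))) = 0.
  apply/le_anti/andP; split; last by rewrite !addr_ge0 // mulr_ge0 // ltW.
  by rewrite tot pmulr_rle0 ?ltr0n // subr_le0.
move/eqP: tot0; rewrite !paddr_eq0 ?addr_ge0 ?mulr_ge0 ?(ltW r_gt0) //.
rewrite !mulf_eq0 gt_eqF //= => /and5P [/eqP f10 /eqP f20 /eqP e10 _ /eqP e30].
have ab i : b i = a i.
  have /eqP := @psumr_eq0P _ _ _ _ (fun j _ => t3 j) e30 i isT.
  by rewrite mulf_eq0 gt_eqF //= expf_eq0 /= subr_eq0 => /eqP.
exists a; split=> // [||i].
- by move: f1E; rewrite f10 => /esym/tr_gram_eq0/subr0_eq.
- move: f2E; rewrite f20 => /esym/tr_gram_eq0/subr0_eq ->.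
  by apply: eq_bigr => i _; rewrite -ab.
have /eqP := @psumr_eq0P _ _ _ _ (fun j _ => t1 j) e10 i isT.
rewrite mulf_eq0 subr_eq0 expf_eq0 /= => /orP [/eqP->//|/eqP->].
by rewrite !mulr0.
Qed.

Lemma top_pair_comb c c' X Y X' Y' : c \is Num.real -> c' \is Num.real ->
  top_pair X Y -> top_pair X' Y' ->
  top_pair (c *: X + c' *: X') (c *: Y + c' *: Y').
Proof.
move=> cR cR' [a [aR -> -> la]] [b [bR -> -> lb]].
exists (fun i => c * a i + c' * b i); split=> [i|||i].
- by rewrite realD ?realM.
- rewrite !scaler_sumr -big_split; apply: eq_bigr => i _ /=.
  by rewrite scalerDl !scalerA.
- rewrite !scaler_sumr -big_split; apply: eq_bigr => i _ /=.
  by rewrite scalerDl !scalerA.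
- by rewrite !mulrDr ![_ * (c * _)]mulrCA ![_ * (c' * _)]mulrCA la lb.
Qed.

Lemma top_pair_basis i : l i = r -> top_pair (g i) (d i).
Proof.
move=> li; exists (fun j => (j == i)%:R); split=> [j|||j].
- exact: realn.
- rewrite (bigD1 i) //= eqxx scale1r big1 ?addr0 // => j /negPf ->.
  by rewrite scale0r.
- rewrite (bigD1 i) //= eqxx scale1r big1 ?addr0 // => j /negPf ->.
  by rewrite scale0r.
- by case: eqP => [->|_]; rewrite ?li // !mulr0.
Qed.

(** Reduces a trace against [A] to a trace on one factor, through the eigenvalue equation on the
    coefficients. *)
Lemma tr_top_pair X Y Y' : top_pair X Y ->
  \tr (A *m (X *t Y')) = r * \tr (Y *m Y').
Proof.
move=> [a [_ -> -> la]]; rewrite tr_schmidt (tr_mul_combination d) mulr_sumr.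
by apply: eq_bigr => i _; rewrite coef_combination // !mulrA la.
Qed.

Lemma tr_top_pair_r X Y X' : top_pair X Y ->
  \tr (A *m (X' *t Y)) = r * \tr (X *m X').
Proof.
move=> [a [_ -> -> la]]; rewrite tr_schmidt (tr_mul_combination g) mulr_sumr.
apply: eq_bigr => i _; rewrite coef_combination // [\tr _ * _]mulrC.
by rewrite !mulrA la.
Qed.

Lemma tr_sqr_top_pair X Y : top_pair X Y -> \tr (X *m X) = \tr (Y *m Y).
Proof. by move=> [a [_ -> -> _]]; rewrite !tr_sqr_combination. Qed.

(** * Stability of top pairs under spectral parts *)

Hypothesis pA : psd A.

Lemma top_pair_abs X Y : top_pair X Y ->
  top_pair (pospart X + negpart X) (pospart Y + negpart Y).
Proof.
move=> tXY; have [hX hY] := top_pair_herm tXY.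
have hD j (Z : 'M[C]_j) : Z \is hermsymmx ->
    pospart Z + negpart Z \is hermsymmx.
  move=> hZ; apply/hermP; rewrite adjmxD.
  by rewrite !(hermP _ (psd_herm _)) //;
    [apply: psd_negpart|apply: psd_pospart].
apply: (@top_pair_extremal (\tr (Y *m Y))); rewrite ?hD ?tr_sqr_abs //.
  exact: tr_sqr_top_pair.
have psdP j (Z : 'M[C]_j) := @psd_pospart C j Z.
have psdN j (Z : 'M[C]_j) := @psd_negpart C j Z.
rewrite -(tr_top_pair Y tXY) -[X in A *m (X *t _)](pospartB hX).
rewrite -[X in A *m (_ *t X)](pospartB hY).
have P1 := tr_psd_mul_ge0 pA (psd_tens (psdP _ _ hX) (psdN _ _ hY)).
have P2 := tr_psd_mul_ge0 pA (psd_tens (psdN _ _ hX) (psdP _ _ hY)).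
move: (pospart X) (negpart X) (pospart Y) (negpart Y) P1 P2 => P N P' N' P1 P2.
(* Passing to absolute values adds twice the mixed terms, which are positive semidefinite and so
   have nonnegative trace against [A]. *)
have -> : (P + N) *t (P' + N')
    = (P - N) *t (P' - N') + 2 *: (P *t N') + 2 *: (N *t P').
  by apply/matrixP => a b; rewrite !mxE; ring.
rewrite !mulmxDr !mxtraceD -!scalemxAr !mxtraceZ -addrA lerDl.
by rewrite addr_ge0 // mulr_ge0 // ler0n.
Qed.

(** The parts are (|X| + X)/2 and (|X| - X)/2, real combinations of two top pairs. *)
Lemma top_pair_parts X Y : top_pair X Y ->
  top_pair (pospart X) (pospart Y) /\ top_pair (negpart X) (negpart Y).
Proof.
move=> tXY; have [hX hY] := top_pair_herm tXY.
have hR : (2^-1 : C) \is Num.real by rewrite realV realn.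
have half j (Z : 'M[C]_j) : 2^-1 *: Z + 2^-1 *: Z = Z.
  by rewrite -scalerDl -{1 2}[2^-1]mul1r -splitr scale1r.
have pos j (Z : 'M[C]_j) : Z \is hermsymmx ->
    pospart Z = 2^-1 *: (pospart Z + negpart Z) + 2^-1 *: Z.
  move=> hZ; move: (pospart Z) (negpart Z) (pospartB hZ) => P N <-.
  rewrite -scalerDr addrACA subrr addr0 scalerDr.
  by rewrite half.
have neg j (Z : 'M[C]_j) : Z \is hermsymmx ->
    negpart Z = 2^-1 *: (pospart Z + negpart Z) + (- 2^-1) *: Z.
  move=> hZ; move: (pospart Z) (negpart Z) (pospartB hZ) => P N <-.
  by rewrite scaleNr -scalerBr opprB addrC addrA subrK scalerDr half.
split; [rewrite (pos _ _ hX) (pos _ _ hY)|rewrite (neg _ _ hX) (neg _ _ hY)];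
  by apply: top_pair_comb; rewrite ?realN //; apply: top_pair_abs.
Qed.

(** The interface through which PPT or SPC enters: once [A] kills the mixed projections, only the
    block linking V (x) W to its complementary pair can obstruct a block decomposition. *)
Definition splits (V : 'M[C]_k) (W : 'M[C]_m) :=
  A *m (V *t (1%:M - W)) = 0 -> A *m ((1%:M - V) *t W) = 0 ->
  (V *t W) *m A *m ((1%:M - V) *t (1%:M - W)) = 0.

(** [ppt_kernel] for [V] and 1 - W gives (V (x) 1) A (1 (x) (1 - W)) = 0; multiplying by 1 (x) W on
    the left and (1 - V) (x) 1 on the right gives the block. *)
Lemma ppt_splits V W : psd (ptrans1 A) ->
  herm_projection V -> herm_projection W -> splits V W.
Proof.
move=> pA' hV hW /ppt_kernel AVW _.
have e : (1%:M *t W) *m ((V *t 1%:M) *m A *m (1%:M *t (1%:M - W)))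
    *m ((1%:M - V) *t 1%:M) = 0.
  by rewrite AVW ?mulmx0 ?mul0mx //; apply: herm_projection_compl.
rewrite -{}[RHS]e !mulmxA tensmx_mul mul1mx mulmx1.
by rewrite -[RHS]mulmxA tensmx_mul mul1mx mulmx1.
Qed.

(** * Consequences of weak irreducibility *)

Hypothesis wA : weak_irreducible A.
Hypothesis A_splits :
  forall X Y, top_pair X Y -> splits (range_proj X) (range_proj Y).

Lemma top_pair_range_proj X Y : top_pair X Y -> X != 0 -> psd X -> psd Y ->
  (forall i, range_proj X *m g i = g i) /\
  (forall i, range_proj Y *m d i = d i).
Proof.
move=> tXY X0 pX pY; have [hX hY] := top_pair_herm tXY.
have r_gt0 : 0 < r := l_gt0 ord0.
have split := A_splits tXY.
have := range_proj_mul hX; have := range_proj_mul hY.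
have [Z] := range_proj_image hX; have [Z'] := range_proj_image hY.
have := herm_projection_range_proj hX; have := herm_projection_range_proj hY.
move: (range_proj X) (range_proj Y) split => V W split pW pV WE VE WY VX.
have [hV VV] := pV; have [hW WW] := pW.
have pV' := herm_projection_compl pV; have pW' := herm_projection_compl pW.
have [hV' _] := pV'; have [hW' _] := pW'.
have XV' : X *m (1%:M - V) = 0.
  by rewrite mulmxBr mulmx1 -{2}(hermP _ hX) -(hermP _ hV) -adjmxM VX
     (hermP _ hX) subrr.
have YW' : Y *m (1%:M - W) = 0.
  by rewrite mulmxBr mulmx1 -{2}(hermP _ hY) -(hermP _ hW) -adjmxM WY
     (hermP _ hY) subrr.
(* The trace of A (X (x) (1 - W)) is r tr(Y (1 - W)) = 0, so the product vanishes by positivity; [V]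
   replaces [X] because it is a right multiple of it. *)
have AVW' : A *m (V *t (1%:M - W)) = 0.
  have /(tr_psd_mul_eq0 pA) e : \tr (A *m (X *t (1%:M - W))) = 0.
    by rewrite (tr_top_pair _ tXY) YW' mxtrace0 mulr0.
  rewrite VE -[1%:M - W]mulmx1 -tensmx_mul mulmxA e ?mul0mx //.
  exact: psd_tens (herm_projection_psd pW').
have AV'W : A *m ((1%:M - V) *t W) = 0.
  have /(tr_psd_mul_eq0 pA) e : \tr (A *m ((1%:M - V) *t Y)) = 0.
    by rewrite (tr_top_pair_r _ tXY) XV' mxtrace0 mulr0.
  rewrite WE -[1%:M - V]mulmx1 -tensmx_mul mulmxA e ?mul0mx //.
  exact: psd_tens (herm_projection_psd pV') pY.
have htens (P : 'M[C]_k) (Q : 'M[C]_m) : P \is hermsymmx ->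
    Q \is hermsymmx -> P *t Q \is hermsymmx.
  by move=> /hermP hP /hermP hQ; apply/hermP; rewrite adjmx_tens hP hQ.
have eA2 : A = A *m (V *t W) + A *m ((1%:M - V) *t (1%:M - W)).
  rewrite -[LHS]mulmx1 -tens1 -[X in X *t _](subrK V) -[X in _ *t X](subrK W).
  move: (1%:M - V) (1%:M - W) AVW' AV'W => V' W' e1 e2.
  by rewrite tensDl !tensDr !mulmxDr e1 e2 addr0 add0r addrC.
have blocks := block_split (psd_herm pA) (htens _ _ hV hW)
  (htens _ _ hV' hW') eA2 (split AVW' AV'W).
have VV' : V *m (1%:M - V) = 0 by rewrite mulmxBr mulmx1 VV subrr.
have WW' : W *m (1%:M - W) = 0 by rewrite mulmxBr mulmx1 WW subrr.
have [_ /(_ V (1%:M - V) W (1%:M - W))] := wA.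
case=> //; rewrite ?[_ + (1%:M - _)]addrC ?subrK //.
  (* The first block cannot vanish: X (x) Y is supported on it, and its trace against [A] is r tr(Y
     Y) = r tr(X X), nonzero as [X] is. *)
  move=> e0; case/eqP: X0; apply: (tr_gram_eq0 (X := X)).
  rewrite (hermP _ hX) (tr_sqr_top_pair tXY).
  apply: (mulfI (lt0r_neq0 r_gt0)); rewrite mulr0 -(tr_top_pair _ tXY).
  have -> : X *t Y = (V *t W) *m (X *t Y) *m (V *t W).
    rewrite !tensmx_mul VX WY -{1}[X](subrK 0) subr0 addr0.
    move: XV' YW'; rewrite !mulmxBr !mulmx1.
    by move=> /subr0_eq <- /subr0_eq <-.
  by rewrite mulmxA mxtrace_mulC !mulmxA e0 mul0mx mxtrace0.
(* Now [A] is its first block, so V (x) 1 and 1 (x) W fix it from the left. *)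
move=> e0; rewrite e0 addr0 in blocks.
split=> i.
  suff : (V *t 1%:M) *m A = A by move/schmidt_fix_l; apply.
  by rewrite [in LHS]blocks !mulmxA tensmx_mul VV mul1mx -blocks.
suff : (1%:M *t W) *m A = A by move/schmidt_fix_r; apply.
by rewrite [in LHS]blocks !mulmxA tensmx_mul WW mul1mx -blocks.
Qed.

Lemma weak_irreducible_im_sub :
  (forall i, im_sub (g i) (g ord0)) /\ (forall i, im_sub (d i) (d ord0)).
Proof.
have tgd : top_pair (g ord0) (d ord0) by apply: top_pair_basis.
have [hg0 hd0] := top_pair_herm tgd.
have psd_abs j (Z : 'M[C]_j) : Z \is hermsymmx -> psd (pospart Z + negpart Z).
  move=> hZ; rewrite /pospart /negpart fcalcD; apply: psd_fcalc => // x xR.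
  by case: (real_ge0P xR) => x0; rewrite ?addr0 // add0r oppr_ge0 ltW.
have abs0 : pospart (g ord0) + negpart (g ord0) != 0.
  apply: contraNneq (orthonormal_neq0 hg ord0) => e0.
  apply/eqP/tr_gram_eq0; rewrite (hermP _ hg0) -tr_sqr_abs // e0 mulmx0.
  exact: mxtrace0.
have [gi di] := top_pair_range_proj (top_pair_abs tgd) abs0
  (psd_abs _ _ hg0) (psd_abs _ _ hd0).
(* The projection is |Z| times a pseudo-inverse and |Z| is [Z] times its sign, so the image of the
   projection lies in that of [Z]. *)
have im_range_proj j (Z : 'M[C]_j) : Z \is hermsymmx ->
    exists T : 'M[C]_j, range_proj (pospart Z + negpart Z) = Z *m T.
  move=> hZ; have [T ->] := range_proj_image (psd_herm (psd_abs _ _ hZ)).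
  by have [S ->] := pospartD_image hZ; exists (S *m T); rewrite mulmxA.
split=> i.
  by have [T e] := im_range_proj _ _ hg0; rewrite -gi e -mulmxA im_sub_mul.
by have [T e] := im_range_proj _ _ hd0; rewrite -di e -mulmxA im_sub_mul.
Qed.

(* Otherwise the top singular space contains a nonzero traceless [X], whose
   positive and negative parts are both nonzero and have orthogonal ranges. *)
Lemma weak_irreducible_simple i : i != ord0 -> l i != r.
Proof.
move=> i0; apply/eqP => li.
have t0 : top_pair (g ord0) (d ord0) by apply: top_pair_basis.
have ti : top_pair (g i) (d i) by apply: top_pair_basis.
have trR j : \tr (g j) \is Num.real.
  by rewrite -[g j]mulmx1 tr_herm_real ?hg.1 //; apply: hermitian1mx_subproof.
have [X [Y [tXY trX X0]]] : exists X Y, [/\ top_pair X Y, \tr X = 0 & X != 0].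
  have [e0|ne0] := eqVneq (\tr (g ord0)) 0.
    by exists (g ord0), (d ord0); split=> //; apply: orthonormal_neq0.
  (* The coefficients cancel the trace, and the one on [g i] is nonzero. *)
  pose X := \tr (g i) *: g ord0 + (- \tr (g ord0)) *: g i.
  exists X, (\tr (g i) *: d ord0 + (- \tr (g ord0)) *: d i); split.
  - by apply: top_pair_comb; rewrite ?realN.
  - by rewrite mxtraceD !mxtraceZ mulNr mulrC subrr.
  apply/eqP => X0; have : \tr (X *m g i) = 0 by rewrite X0 mul0mx mxtrace0.
  rewrite mulmxDl mxtraceD -!scalemxAl !mxtraceZ !(tr_orthonormal hg) eqxx.
  rewrite eq_sym (negPf i0) mulr0 add0r mulr1 => /eqP.
  by rewrite oppr_eq0 (negPf ne0).
have [hX hY] := top_pair_herm tXY; have [tP tN] := top_pair_parts tXY.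
have trPN : \tr (pospart X) = \tr (negpart X).
  apply/eqP; rewrite -subr_eq0 -trX -{3}(pospartB hX) mxtraceD.
  by apply/eqP; congr (_ + _); rewrite raddfN.
have pP := psd_pospart hX; have pN := psd_negpart hX.
have P0 : pospart X != 0.
  apply: contraNneq X0 => P0; rewrite -(pospartB hX) P0.
  rewrite (psd_tr_eq0 pN) ?subr0 //.
  by rewrite -trPN P0 mxtrace0.
have [fixg _] := top_pair_range_proj tP P0 pP (psd_pospart hY).
(* The negative part is a combination of the g_j, all fixed by the range projection of the positive
   part. Orthogonality of the parts will then force it to be 0. *)
have fixN : range_proj (pospart X) *m negpart X = negpart X.
  have [a [_ -> _ _]] := tN; rewrite mulmx_sumr; apply: eq_bigr => j _.
  by rewrite -scalemxAr fixg.
have [Z eZ] := range_proj_image (psd_herm pP).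
have hN := psd_herm pN.
have NP : negpart X *m pospart X = 0.
  rewrite -(hermP _ hN) -(hermP _ (psd_herm pP)) -adjmxM pos_neg_mul0 //.
  exact: adjmx0.
have N0 : negpart X = 0.
  apply: herm_sqr_eq0 => //; rewrite -{2}fixN eZ.
  by rewrite -[pospart X *m Z *m _]mulmxA [LHS]mulmxA NP mul0mx.
case/eqP: P0; apply: psd_tr_eq0 => //.
by rewrite trPN N0 mxtrace0.
Qed.

End SchmidtDecomposition.

(** * From the three conditions to weak irreducibility *)

Section Converse.
Variable C : numClosedFieldType.
Variables k m n : nat.
Variable l : 'I_n.+1 -> C.
Variables (g : 'I_n.+1 -> 'M[C]_k) (d : 'I_n.+1 -> 'M[C]_m).
Variable A : 'M[C]_(k * m).
Hypothesis l_gt0 : forall i, 0 < l i.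
Hypothesis hg : orthonormal_herm g.
Hypothesis hd : orthonormal_herm d.
Hypothesis eA : A = \sum_i l i *: (g i *t d i).

(* Comparing coefficients in [(V1 (x) 1) A = (1 (x) W1) A] shows that [g 0] is
   an eigenvector of [V1], so that one of the blocks annihilates it. *)
Lemma simple_weak_irreducible : psd A ->
  (forall i, i != ord0 -> l i < l ord0) ->
  (forall i, im_sub (g i) (g ord0)) -> weak_irreducible A.
Proof.
move=> pA l_lt im_g; split=> // V1 V2 W1 W2 [hV1 VV1] _ [hW1 WW1] _.
move=> V12 W12 eV eW eA2.
have V21 : V2 *m V1 = 0.
  by rewrite -[V2](addKr V1) eV mulmxDl mulNmx VV1 mul1mx addrC subrr.
have VA : (V1 *t 1%:M) *m A = (V1 *t W1) *m A *m (V1 *t W1).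
  rewrite {1}eA2 mulmxDr !mulmxA !tensmx_mul VV1 V12 !mul1mx tens0mx.
  by rewrite !mul0mx addr0.
have WA : (1%:M *t W1) *m A = (V1 *t W1) *m A *m (V1 *t W1).
  rewrite {1}eA2 mulmxDr !mulmxA !tensmx_mul WW1 W12 !mul1mx tensmx0.
  by rewrite !mul0mx addr0.
(* Either one-sided projection selects the first block. *)
have VWA : (V1 *t 1%:M) *m A = (1%:M *t W1) *m A by rewrite VA WA.
have lR i : (l i)^* = l i by apply/CrealP/ger0_real/ltW.
pose a p q := \tr (V1 *m g q *m g p); pose b p q := \tr (W1 *m d p *m d q).
have aC p q : (a p q)^* = a q p.
  rewrite /a -tr_adjmx !adjmxM !(hermP _ (hg.1 _)) (hermP _ hV1).
  by rewrite mulmxA mxtrace_mulC mulmxA.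
have bC p q : (b p q)^* = b q p.
  rewrite /b -tr_adjmx !adjmxM !(hermP _ (hd.1 _)) (hermP _ hW1).
  by rewrite mulmxA mxtrace_mulC mulmxA.
have sumVA : (V1 *t 1%:M) *m A = \sum_i (l i *: (V1 *m g i)) *t d i.
  rewrite eA mulmx_sumr; apply: eq_bigr => i _.
  by rewrite -scalemxAr tensmx_mul mul1mx tensZl.
have sumWA : (1%:M *t W1) *m A = \sum_i (l i *: g i) *t (W1 *m d i).
  rewrite eA mulmx_sumr; apply: eq_bigr => i _.
  by rewrite -scalemxAr tensmx_mul mul1mx tensZl.
have contract q : l q *: (V1 *m g q) = \sum_i (b i q * l i) *: g i.
  have := congr1 (partial_trace (d q)) VWA.
  rewrite sumVA sumWA !partial_trace_sum (bigD1 q) //= (tr_orthonormal hd).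
  rewrite eqxx scale1r big1 ?addr0 => [->|i /negPf iq].
    by apply: eq_bigr => i _; rewrite scalerA.
  by rewrite (tr_orthonormal hd) iq scale0r.
have lab p q : l q * a p q = l p * b p q.
  have := congr1 (fun X => \tr (g p *m X)) (contract q).
  rewrite (coef_combination hg) -scalemxAr mxtraceZ mulrC => e.
  by rewrite [RHS]mulrC -e mulrC /a [in RHS]mxtrace_mulC.
(* [lab] at (p, 0), together with the conjugate of [lab] at (0, p), gives l_0^2 b_p0 = l_0 l_p a_p0
   = l_p^2 b_p0, and l_p < l_0. *)
have b0 p : p != ord0 -> b p ord0 = 0.
  move=> /l_lt lp; have := lab p ord0.
  have := congr1 (fun x : C => x^*) (lab ord0 p).
  rewrite /= !rmorphM /= !lR aC bC => e1 e2.
  have /eqP : (l ord0 ^+ 2 - l p ^+ 2) * b p ord0 = 0.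
    rewrite mulrBl !expr2 -!mulrA -e2 -e1 mulrCA subrr //.
  rewrite subr_sqr !mulf_eq0 subr_eq0 [l ord0 == _]gt_eqF //=.
  by rewrite gt_eqF ?addr_gt0 //= => /eqP.
have Vg0 : V1 *m g ord0 = b ord0 ord0 *: g ord0.
  apply: (scalerI (lt0r_neq0 (l_gt0 ord0))); rewrite contract (bigD1 ord0) //=.
  rewrite big1 ?addr0 => [|i i0]; first by rewrite scalerA mulrC.
  by rewrite b0 // mul0r scale0r.
(* The image inclusions make every g_i a right multiple of g_0. *)
have kill P Q : P *m g ord0 = 0 -> (P *t Q) *m A = 0.
  move=> P0; rewrite eA mulmx_sumr big1 // => i _.
  have /submxP [D /(congr1 trmx)] := im_g i.
  rewrite trmx_mul !trmxK -scalemxAr tensmx_mul => ->.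
  by rewrite mulmxA P0 mul0mx tens0mx scaler0.
have /eqP : b ord0 ord0 *: (V2 *m g ord0) = 0.
  by rewrite scalemxAr -Vg0 mulmxA V21 mul0mx.
rewrite scaler_eq0 => /orP [/eqP b00|/eqP V2g0]; [left|right].
  by rewrite kill ?mul0mx // Vg0 b00 scale0r.
by rewrite kill ?mul0mx.
Qed.

End Converse.

(** * The splitting property for SPC matrices *)

Section SpcSplits.
Variable C : numClosedFieldType.
Variables k n : nat.
Variable l : 'I_n.+1 -> C.
Variable g : 'I_n.+1 -> 'M[C]_k.
Variable A : 'M[C]_(k * k).
Hypothesis l_gt0 : forall i, 0 < l i.
Hypothesis hg : orthonormal_herm g.
Hypothesis eA : A = \sum_i l i *: (g i *t g i).

(* With [B_i = (1 - V) g_i V], the hypothesis gives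
   [\sum_i l_i B_i (x) B_i^* = 0], hence [\sum_i l_i B_i B_i^* = 0]. *)
Lemma spc_splits V : herm_projection V -> splits A V V.
Proof.
move=> pV AVV' _; have [hV' _] := herm_projection_compl pV.
have [hV _] := pV.
pose B i := (1%:M - V) *m g i *m V.
have adjB i : adjmx (B i) = V *m g i *m (1%:M - V).
  by rewrite /B !adjmxM (hermP _ hV) (hermP _ hV') (hermP _ (hg.1 i)) mulmxA.
have BB0 : \sum_i (l i *: B i) *t adjmx (B i) = 0.
  transitivity (((1%:M - V) *t V) *m A *m (V *t (1%:M - V))).
    by rewrite (mul_schmidt eA); apply: eq_bigr => i _; rewrite adjB.
  by rewrite -mulmxA AVV' mulmx0.
have trB0 : \sum_i l i * \tr (B i *m adjmx (B i)) = 0.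
  have := congr1 mxtrace (tens_sum_contract 1%:M BB0).
  rewrite mxtrace0 raddf_sum /= => e; rewrite -[RHS]e.
  by apply: eq_bigr => i _; rewrite mulmx1 -scalemxAl mxtraceZ.
have B0 i : B i = 0.
  have t_ge0 j : 0 <= l j * \tr (B j *m adjmx (B j)).
    by rewrite mulr_ge0 ?tr_gram_ge0 // ltW.
  apply: tr_gram_eq0; apply/eqP.
  have /eqP := @psumr_eq0P _ _ _ _ (fun j _ => t_ge0 j) trB0 i isT.
  by rewrite mulf_eq0 gt_eqF.
rewrite (mul_schmidt eA) big1 // => i _.
by rewrite -adjB B0 adjmx0 tensmx0.
Qed.

End SpcSplits.

(** * The equivalence, first under the splitting property, then in the two cases *)

Lemma weak_irreducible_schmidt (R : realType) k m n (A : 'M[R[i]]_(k * m))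
    (lam : 'I_n.+1 -> R) (g : 'I_n.+1 -> 'M[R[i]]_k)
    (d : 'I_n.+1 -> 'M[R[i]]_m) :
    psd A -> herm_schmidt lam g d A ->
    (forall i j : 'I_n.+1, (i <= j)%N -> lam j <= lam i) ->
    (forall X Y, top_pair (fun i => (lam i)%:C%C) g d X Y ->
      splits A (range_proj X) (range_proj Y)) ->
  weak_irreducible A <-> schmidt_conditions lam g d.
Proof.
move=> pA [lam_gt0 hg hd eA] lam_mono A_splits.
have l_gt0 i : 0 < (lam i)%:C%C by rewrite ltcR.
have l_max i : (lam i)%:C%C <= (lam ord0)%:C%C by rewrite lecR lam_mono.
split=> [wA|[[lam_lt _ _] im_g im_d]].
  have [im_g im_d] :=
    weak_irreducible_im_sub l_gt0 hg hd eA l_max pA wA A_splits.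
  split=> //; split=> // [i i1|i j _]; last exact: lam_mono.
  have i0 : i != ord0 by rewrite -val_eqE /= i1.
  have := weak_irreducible_simple l_gt0 hg hd eA l_max pA wA A_splits i0.
  by rewrite lt_neqAle lam_mono // andbT; apply: contra => /eqP ->.
apply: (simple_weak_irreducible l_gt0 hg hd eA) => // i i0.
rewrite ltcR; have i_gt0 : (0 < i)%N by rewrite lt0n.
(* A nonzero index guarantees that index 1 exists, and then lam_i <= lam_1 < lam_0. *)
have n_gt0 : (1 < n.+1)%N := leq_ltn_trans i_gt0 (ltn_ord i).
exact: le_lt_trans (lam_mono (Ordinal n_gt0) i i_gt0)
  (lam_lt (Ordinal n_gt0) erefl).
Qed.

Theorem theorem3p4 (R : realType) :
  (forall (k n : nat) (A : 'M[R[i]]_(k * k)) (lam : 'I_n.+1 -> R)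
     (g : 'I_n.+1 -> 'M[R[i]]_k),
     A != 0 -> SPC A -> herm_schmidt lam g g A ->
     (forall i j : 'I_n.+1, (i <= j)%N -> lam j <= lam i) ->
     (weak_irreducible A <-> schmidt_conditions lam g g))
  /\
  (forall (k m n : nat) (A : 'M[R[i]]_(k * m)) (lam : 'I_n.+1 -> R)
     (g : 'I_n.+1 -> 'M[R[i]]_k) (d : 'I_n.+1 -> 'M[R[i]]_m),
     A != 0 -> PPT A -> herm_schmidt lam g d A ->
     (forall i j : 'I_n.+1, (i <= j)%N -> lam j <= lam i) ->
     (weak_irreducible A <-> schmidt_conditions lam g d)).
Proof.
split=> [k n A lam g _ [pA _]|k m n A lam g d _ [pA pA']] sA lam_mono;
  have [lam_gt0 hg hd eA] := sA;
  have l_gt0 i : 0 < (lam i)%:C%C by rewrite ?ltcR.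
  apply: weak_irreducible_schmidt => // X Y tXY.
  have [hX _] := top_pair_herm hg hg tXY.
  (* Both families are [g] here, so the two projections coincide, as [spc_splits] requires. *)
  have -> : Y = X by have [a [_ -> -> _]] := tXY.
  by apply: (spc_splits l_gt0 hg eA); apply: herm_projection_range_proj.
apply: weak_irreducible_schmidt => // X Y tXY.
have [hX hY] := top_pair_herm hg hd tXY.
by apply: (ppt_splits eA) => //; apply: herm_projection_range_proj.
Qed.
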